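(* Let $K$ be a field, let $\Gamma$ be a convex polytope in $\mathbb R^2$ with integral vertex coordinates and write $\mathcal S=\Gamma\cap\mathbb Z^2$. Then the set of points $(f_{i,j})_{(i,j)\in\mathcal S}\in\mathbb A_K^{\#\mathcal S}$ for which $f=\sum_{(i,j)\in\mathcal S} f_{i,j}x^iy^j$ is not nondegenerate with respect to its Newton polytope is contained in an algebraic set of codimension $\ge1$. Moreover, this algebraic set is defined over the prime subfield of $K$.
   Context: The Newton polytope $\Gamma(f)$ of a Laurent polynomial $f=\sum f_{i,j}x^iy^j$ is the convex hull in $\mathbb R^2$ of its support $\{(i,j):f_{i,j}\neq0\}$. For a face $\gamma$ of $\Gamma(f)$ (a vertex, an edge, or $\Gamma(f)$ itself) put $f_\gamma=\sum_{(i,j)\in\gamma\cap\mathbb Z^2}f_{i,j}x^iy^j$. $f$ is nondegenerate with respect to its Newton polytope if for all faces $\gamma$ of $\Gamma(f)$ the system $f_\gamma=x\frac{\partial f_\gamma}{\partial x}=y\frac{\partial f_\gamma}{\partial y}=0$ has no solutions in $(\overline K\setminus\{0\})^2$, where $\overline K$ is an algebraic closure of $K$. *)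

(* Defs.v *)
From HB Require Import structures.
From mathcomp Require Import all_boot all_order all_algebra.
From mathcomp Require Import finmap.
From mathcomp Require Import boolp classical_sets cardinality reals.
From mathcomp Require Import interval_inference convex.
From mathcomp Require Import mpoly.

Set Implicit Arguments.
Unset Strict Implicit.
Unset Printing Implicit Defensive.

Import Order.TTheory GRing.Theory Num.Theory.
Local Open Scope classical_set_scope.
Local Open Scope ring_scope.

Definition intpt (R : realType) (m : int * int) : 'rV[R]_2 :=
  \row_k (if k == 0 then m.1 else m.2)%:~R.

Definition conv_hull (R : realType) (V : lmodType R) (A : set V) : set V :=
  smallest (@convex_set R V) A.

Definition integral_polytope (R : realType) (P : set 'rV[R]_2) : Prop :=
  exists2 s : seq (int * int),
    s != [::] & P = conv_hull (@intpt R @` [set` s]).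

(* The set of points of P where a linear functional attains its maximum on P.
   For a polygon these are the vertices, the edges and (l = 0) P itself.  The
   empty set is a face only of P = set0, the Newton polytope of 0, so that the
   zero Laurent polynomial is degenerate. *)
Definition is_face (R : realType) (V : lmodType R) (P g : set V) : Prop :=
  exists l : {scalar V}, g = [set p | P p /\ forall q, P q -> l q <= l p].

(* [fset_set] is only meaningful on finite sets: see [mem_lattice_points]. *)
Definition lattice_points (R : realType) (P : set 'rV[R]_2) :
    {fset int * int} :=
  fset_set [set m | P (intpt R m)].

Lemma mem_lattice_points (R : realType) (P : set 'rV[R]_2) :
  integral_polytope P ->
  forall m, (m \in lattice_points P) <-> P (intpt R m).
Proof.
case=> s _ ->; set H := conv_hull _.
suff fin : finite_set [set m | H (intpt R m)].
  by move=> m; rewrite in_fset_set// inE.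
pose b := (\max_(m <- s) maxn `|m.1| `|m.2|)%N.
pose B : set 'rV[R]_2 := [set p | forall k, `|p 0 k| <= b%:R].
have HB : H `<=` B.
  apply: smallest_sub; last first.
    move=> _ [m /= ms <-] k; rewrite mxE -intr_norm -abszE -pmulrn ler_nat.
    apply: (leq_trans _ (leq_bigmax_seq m ms isT)).
    by case: ifP; rewrite ?leq_maxl ?leq_maxr.
  move=> x y t; rewrite !inE /= => Bx By k; rewrite !mxE.
  have t0 : 0 <= t%:num by [].
  have t1 : t%:num <= 1 by [].
  apply: le_trans (ler_normD _ _) _; rewrite !normrM.
  rewrite (ger0_norm t0) (@ger0_norm _ (1 - _)) ?subr_ge0//.
  rewrite [leRHS](_ : _ = t%:num * b%:R + (1 - t%:num) * b%:R); last first.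
    by rewrite -mulrDl addrC subrK mul1r.
  by apply: lerD; apply: ler_wpM2l; rewrite ?subr_ge0.
pose f (i j : 'I_(b.*2.+1)) : int * int := (i%:Z - b%:Z, j%:Z - b%:Z).
apply: (@sub_finite_set _ _ ((fun ij => f ij.1 ij.2) @` setT)); last first.
  by apply: finite_image; exact: finite_finset.
have inI (z : int) : `|z%:~R : R| <= b%:R ->
    exists i : 'I_(b.*2.+1), z = i%:Z - b%:Z.
  rewrite -intr_norm -[b%:R]/((b%:Z)%:~R) ler_int ler_norml => /andP[z1 z2].
  have zb : 0 <= z + b%:Z by rewrite -lerBlDr sub0r.
  have lt : (`|(z + b%:Z)%R| < b.*2.+1)%N.
    by rewrite ltnS -lez_nat gez0_abs// -addnn PoszD lerD2r.
  by exists (Ordinal lt); rewrite /= gez0_abs// addrK.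
move=> [m1 m2] /= /HB mB.
have [i ->] : exists i : 'I_(b.*2.+1), m1 = i%:Z - b%:Z.
  by apply: inI; have := mB 0; rewrite mxE.
have [j ->] : exists i : 'I_(b.*2.+1), m2 = i%:Z - b%:Z.
  by apply: inI; have := mB 1; rewrite mxE.
by exists (i, j).
Qed.

(* [f (i, j)] is the coefficient of x^i y^j; exponents may be negative. *)
Definition laurent (F : fieldType) := {fsfun int * int -> F with 0}.

Definition ddx (F : fieldType) (f : laurent F) : laurent F :=
  [fsfun m in [fset (n.1 - 1, n.2) | n in finsupp f]%fset =>
     f (m.1 + 1, m.2) *~ (m.1 + 1) | 0].

Definition ddy (F : fieldType) (f : laurent F) : laurent F :=
  [fsfun m in [fset (n.1, n.2 - 1) | n in finsupp f]%fset =>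
     f (m.1, m.2 + 1) *~ (m.2 + 1) | 0].

Definition leval (F E : fieldType) (j : {rmorphism F -> E}) (f : laurent F)
    (x y : E) : E :=
  \sum_(m <- finsupp f) j (f m) * x ^ m.1 * y ^ m.2.

Definition newton_polytope (R : realType) (F : fieldType) (f : laurent F) :
    set 'rV[R]_2 :=
  conv_hull (@intpt R @` [set` finsupp f]).
Arguments newton_polytope R {F} f _.

Definition face_part (R : realType) (F : fieldType) (f : laurent F)
    (g : set 'rV[R]_2) : laurent F :=
  [fsfun m in [fset n in finsupp f | `[< g (intpt R n) >]]%fset => f m | 0].

(* [j] is meant to embed F in an algebraic closure of F. *)
Definition newton_nondegenerate (R : realType) (F : fieldType)
    (Fbar : closedFieldType) (j : {rmorphism F -> Fbar}) (f : laurent F) :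
    Prop :=
  forall g : set 'rV[R]_2, is_face (newton_polytope R f) g ->
  ~ exists x y : Fbar,
      [/\ x != 0, y != 0,
          leval j (face_part f g) x y = 0,
          x * leval j (ddx (face_part f g)) x y = 0 &
          y * leval j (ddy (face_part f g)) x y = 0].

(* The Laurent polynomial with exponents in S whose coefficient vector, along
   the standard enumeration of S, is v. *)
Definition laurent_of (F : fieldType) (S : {fset int * int})
    (v : 'I_#|{: S}| -> F) : laurent F :=
  [fsfun m : S => v (enum_rank m) | 0].

Definition zero_locus (F : fieldType) (n : nat) (I : set {mpoly F[n]}) :
    set ('I_n -> F) :=
  [set v | forall p, I p -> p.@[v] = 0].

Definition algebraic_set (F : fieldType) (n : nat) (V : set ('I_n -> F)) :
    Prop :=
  exists I : set {mpoly F[n]}, V = zero_locus I.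

Definition irreducible_closed (F : fieldType) (n : nat)
    (Y : set ('I_n -> F)) : Prop :=
  [/\ algebraic_set Y, Y !=set0 &
      forall A B, algebraic_set A -> algebraic_set B ->
        Y = A `|` B -> Y = A \/ Y = B].

(* The codimension of V in affine n-space is the minimum, over the irreducible
   closed subsets Y0 of V, of the supremum of the lengths k of the chains
   Y0 < Y1 < ... < Yk of irreducible closed subsets of affine n-space (infinite
   if V is empty). *)
Definition codim_ge (F : closedFieldType) (n : nat) (V : set ('I_n -> F))
    (k : nat) : Prop :=
  forall Y0, irreducible_closed Y0 -> Y0 `<=` V ->
  exists Y : nat -> set ('I_n -> F),
    [/\ Y 0%N = Y0,
        forall i, (i <= k)%N -> irreducible_closed (Y i) &
        forall i, (i < k)%N -> Y i `<` Y i.+1].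

Definition prime_subfield (K : fieldType) : set K :=
  [set x | forall S : {pred K}, divring_closed S -> x \in S].

Definition defined_over_prime_subfield (K : fieldType)
    (Kbar : closedFieldType) (iota : {rmorphism K -> Kbar}) (n : nat)
    (V : set ('I_n -> Kbar)) : Prop :=
  exists2 I : set {mpoly K[n]},
    forall p, I p -> forall m, prime_subfield p@_m &
    V = zero_locus [set map_mpoly iota p | p in I].

(* Main.v *)
(* Let F be the prime subfield and S the set of lattice points of Gamma.  It is
   enough to find a nonzero polynomial over F in the coefficients c that
   vanishes at every degenerate c.  Including the product of all coordinates as
   a factor, we may assume that every c_m is nonzero; then the support is S, and
   only finitely many sets T of lattice points occur as faces.  Such a T is
   lattice convex, so in every characteristic it contains an affine frame
   p, p + u_1, .., p + u_r (r <= 2) in which all points of T have integer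
   coordinates: a point, two consecutive points of a segment, or a triangle
   without further lattice points.  With t_k := X^(u_k), integer combinations of
   the three equations solve for the r + 1 coefficients at the frame, so the
   degenerate c lie in the image of a polynomial map over F whose n - 1 parameters
   are t_1, .., t_r and the other n - r - 1 coefficients.  Its n components are
   algebraically dependent over F. *)
Require Import Defs.
From HB Require Import structures.
From mathcomp Require Import all_boot all_order all_algebra.
From mathcomp Require Import finmap.
From mathcomp Require Import boolp classical_sets cardinality reals.
From mathcomp Require Import interval_inference convex.
From mathcomp Require Import mpoly.
From mathcomp Require Import zify ring lra.

Set Implicit Arguments.
Unset Strict Implicit.
Unset Printing Implicit Defensive.

Import Order.TTheory GRing.Theory Num.Theory.

Local Open Scope classical_set_scope.
Local Open Scope ring_scope.

(** * Algebraic dependence by counting monomials *)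

Lemma wide_row_kernel (F : fieldType) m n (A : 'M[F]_(m, n)) :
  (n < m)%N -> exists2 v : 'rV_m, v != 0 & v *m A = 0.
Proof.
move=> nm; have : kermx A != 0.
  rewrite -mxrank_eq0 mxrank_ker -lt0n subn_gt0.
  exact: leq_ltn_trans (rank_leq_col A) nm.
case/rowV0Pn => v /sub_kermxP vA v0; by exists v.
Qed.

Lemma leq_msizeM (F : fieldType) n (p q : {mpoly F[n]}) a b :
  (msize p <= a.+1)%N -> (msize q <= b.+1)%N -> (msize (p * q) <= (a + b).+1)%N.
Proof.
move=> pa qb.
have [->|p0] := eqVneq p 0; first by rewrite mul0r msize0.
have [->|q0] := eqVneq q 0; first by rewrite mulr0 msize0.
rewrite msizeM//; move: pa qb; move: (msize p) (msize q) => u v; lia.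
Qed.

Lemma leq_msize_prodX (F : fieldType) n k (P : 'I_n -> {mpoly F[k]})
    (e : 'I_n -> nat) a b :
  (forall i, msize (P i) <= a.+1)%N -> (forall i, e i <= b)%N ->
  (msize (\prod_i P i ^+ e i) <= (n * (b * a)).+1)%N.
Proof.
move=> Pa eb.
have szX i m : (msize (P i ^+ m) <= (m * a).+1)%N.
  elim: m => [|m IH]; first by rewrite expr0 msize1.
  by rewrite exprS mulSn; exact: leq_msizeM.
have : (msize (\prod_(i < n) P i ^+ e i) <= (\sum_(i < n) (b * a)).+1)%N.
  apply: (big_ind2 (fun p d => msize p <= d.+1)%N); first by rewrite msize1.
    by move=> p a' q b'; exact: leq_msizeM.
  by move=> i _; apply: leq_trans (szX _ _) _; rewrite ltnS leq_mul2r eb orbT.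
by rewrite sum_nat_const card_ord.
Qed.

(* There are (D + 1)^(k + 1) monomials in the P i with exponents at most D, in a
   space of dimension at most (B + 1)^k, where B grows linearly with D. *)
Lemma algebraically_dependent (F : fieldType) k
    (P : 'I_k.+1 -> {mpoly F[k]}) :
  exists2 Q : {mpoly F[k.+1]}, Q != 0 & Q \mPo [tuple P i | i < k.+1] = 0.
Proof.
pose M := (\max_(i < k.+1) msize (P i))%N.
have szP i : (msize (P i) <= M.+1)%N.
  by apply: leqW; exact: (leq_bigmax_cond i).
(* [D] bounds the exponents and [B] the degree of the products. As [B + 1 <= C (D + 1)], the choice
   [D = C ^ k] gives [(B + 1)^k <= D (D + 1)^k < (D + 1)^(k + 1)]. *)
pose C := (k.+1 * M).+1; pose D := (C ^ k)%N; pose B := (k.+1 * (D * M))%N.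
pose rows := {ffun 'I_k.+1 -> 'I_D.+1}; pose cols := {ffun 'I_k -> 'I_B.+1}.
have lt_cols_rows : (#|{: cols}| < #|{: rows}|)%N.
  rewrite !card_ffun !card_ord expnS.
  have BC : (B.+1 <= C * D.+1)%N.
    rewrite /B /C; move: (D) (M) => d m; nia.
  apply: (@leq_ltn_trans ((C * D.+1) ^ k)).
    by case: (k) => // ?; rewrite leq_exp2r.
  by rewrite expnMn ltn_pmul2r ?expn_gt0.
pose monr (a : rows) : 'X_{1..k.+1} := [multinom (a i : nat) | i < k.+1].
pose monc (b : cols) : 'X_{1..k} := [multinom (b i : nat) | i < k].
pose Pa (a : rows) := \prod_i P i ^+ a i.
pose A := \matrix_(i < #|{: rows}|, j < #|{: cols}|)
  (Pa (enum_val i))@_(monc (enum_val j)).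
have [v v0 vA] := wide_row_kernel A lt_cols_rows.
have monr_inj : injective monr.
  move=> a b /mnmP ab; apply/ffunP => i; apply/val_inj.
  by have := ab i; rewrite !mnmE.
exists (\sum_i v 0 i *: 'X_[monr (enum_val i)]).
  case/rV0Pn: v0 => i vi; apply/eqP => /(congr1 (mcoeff (monr (enum_val i)))).
  rewrite mcoeff0 raddf_sum /= (bigD1 i)//= big1 ?addr0.
    by rewrite mcoeffZ mcoeffX eqxx mulr1 => /eqP; rewrite (negbTE vi).
  move=> j ji; rewrite mcoeffZ mcoeffX.
  by rewrite (inj_eq monr_inj) (inj_eq enum_val_inj) (negbTE ji) mulr0.
have compE : (\sum_i v 0 i *: 'X_[monr (enum_val i)]) \mPo
    [tuple P i | i < k.+1] = \sum_i v 0 i *: Pa (enum_val i).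
  rewrite raddf_sum /=; apply: eq_bigr => i _; rewrite comp_mpolyZ comp_mpolyX.
  by congr (_ *: _); apply: eq_bigr => l _; rewrite tnth_mktuple mnmE.
rewrite compE; apply/mpolyP => m; rewrite mcoeff0 raddf_sum /=.
(* No product has a monomial of degree above [B]; the other monomials have all exponents at most
   [B], hence are columns of [A]. *)
have [mB|mB] := leqP (mdeg m) B; last first.
  apply: big1 => i _; rewrite mcoeffZ memN_msupp_eq0 ?mulr0//.
  apply: msize_mdeg_ge; apply: leq_trans mB; apply: leq_msize_prodX => // l.
  by rewrite -ltnS.
have lem i : (m i < B.+1)%N.
  by rewrite ltnS (leq_trans _ mB)// mdegE (bigD1 i)//= leq_addr.
pose b : cols := [ffun i => Ordinal (lem i)].
have mb : m = monc b by apply/mnmP => i; rewrite mnmE ffunE.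
have /matrixP/(_ 0 (enum_rank b)) := vA; rewrite !mxE => vA0; rewrite -[RHS]vA0.
by apply: eq_bigr => i _; rewrite mcoeffZ mxE enum_rankK -mb.
Qed.

(** * Elimination of the frame coefficients *)

Lemma meval_map_comp_mpoly (F E : fieldType) (phi : {rmorphism F -> E}) n k
    (Q : {mpoly F[n]}) (P : 'I_n -> {mpoly F[k]}) (w : 'I_k -> E) :
  (map_mpoly phi (Q \mPo [tuple P i | i < n])).@[w] =
  (map_mpoly phi Q).@[fun i => (map_mpoly phi (P i)).@[w]].
Proof.
rewrite comp_mpolyEX [in RHS](mpolyE Q) !(raddf_sum (map_mpoly phi)).
rewrite (raddf_sum (meval w)) (raddf_sum (meval _)) /=.
apply: eq_bigr => m _; rewrite !map_mpolyZ !mevalZ comp_mpolyX map_mpolyX mevalX.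
rewrite !rmorph_prod /=; congr (_ * _); apply: eq_bigr => i _.
by rewrite !rmorphXn /= tnth_mktuple.
Qed.

(** The only frame coefficient in equation [i] is [c (e i)], with factor 1, so the equation gives
    [c (e i)] in terms of [t] and the coefficients off the frame. Then [c] is a value of [n]
    polynomials in [n - 1] parameters, and [Q] is a relation between them. *)
Lemma torus_elimination (F E : fieldType) (phi : {rmorphism F -> E}) n r
    (T : {set 'I_n}) (e : 'I_r.+1 -> 'I_n) (a : 'I_r -> 'I_n -> int)
    (lam : 'I_r.+1 -> 'I_n -> int) :
  (forall i, e i \in T) -> (forall i l, lam i (e l) = (i == l)%:R) ->
  exists2 Q : {mpoly F[n]}, Q != 0 &
    forall (c : 'I_n -> E) (t : 'I_r -> E), (forall k, t k != 0) ->
      (forall i, \sum_(m in T) (lam i m)%:~R * c m * \prod_k t k ^ a k m = 0) ->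
      (map_mpoly phi Q).@[c] = 0.
Proof.
move=> eT lamE.
have e_inj : injective e.
  move=> i l il; have := lamE i l; rewrite -il lamE eqxx.
  by case: eqVneq.
case: n T e a lam eT lamE e_inj => [|n] T e a lam eT lamE e_inj.
  by case: (e ord0).
(* The parameters are indexed by the complement of [e ord0]: [t k] sits at
   [e (lift ord0 k)], and a coefficient [c m] off the frame is replaced by
   [c m / \prod_k t k ^+ N], which clears the negative powers of [t]. *)
pose Y m : {mpoly F[n]} := if unlift (e ord0) m is Some m' then 'X_m' else 1.
pose tau (k : 'I_r) := Y (e (lift ord0 k)).
(* Doubled because [N] has to absorb the difference of two exponents of [t k]. *)
pose N := (\sum_k \sum_m `|a k m|).*2%N.
have leN k m l : 0 <= N%:Z + a k m - a k l.
  have aN m' : (`|a k m'| <= \sum_k \sum_m `|a k m|)%N.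
    by rewrite (bigD1 k)//= (bigD1 m')//= -addnA leq_addr.
  by have := aN m; have := aN l; rewrite /N; lia.
(* Equation [i] divided by the monomial at [e i], without its term at [e i]. *)
pose rest i := \sum_(m in T | m \notin codom e) (lam i m)%:~R * Y m *
  \prod_k tau k ^+ absz (N%:Z + a k m - a k (e i))%R.
pose P m := if [pick i | e i == m] is Some i then - rest i
            else Y m * \prod_k tau k ^+ N.
have [Q Q0 QP] := algebraically_dependent P.
exists Q => // c t t0 ct.
pose W m := if [pick k | e (lift ord0 k) == m] is Some k then t k
            else c m / \prod_k t k ^+ N.
pose w m := W (lift (e ord0) m).
have evY m : m != e ord0 -> (map_mpoly phi (Y m)).@[w] = W m.
  rewrite /Y; case: unliftP => [m' ->|-> /eqP//] _.
  by rewrite map_mpolyX mevalXU.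
have evtau k : (map_mpoly phi (tau k)).@[w] = t k.
  rewrite evY ?(inj_eq e_inj)// /W; case: pickP => [l /eqP/e_inj/lift_inj-> //|].
  by move=> /(_ k); rewrite eqxx.
have W_free m : m \notin codom e -> W m = c m / \prod_k t k ^+ N.
  move=> me; rewrite /W; case: pickP => // k /eqP ekm.
  by rewrite -ekm codom_f in me.
have free_n0 m : m \notin codom e -> m != e ord0.
  by apply: contraNneq => ->; exact: codom_f.
have tN0 : \prod_k t k ^+ N != 0 by apply/prodf_neq0 => k _; exact: expf_neq0.
have evP m : (map_mpoly phi (P m)).@[w] = c m.
  rewrite /P; case: pickP => [i /eqP <-|em]; last first.
    have me : m \notin codom e.
      by apply/negP => /codomP[i mi]; have := em i; rewrite mi eqxx.
    rewrite !rmorphM /= evY ?free_n0// W_free// !rmorph_prod /=.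
    under [X in _ * X]eq_bigr do rewrite !rmorphXn /= evtau.
    by rewrite divfK.
  have te0 : \prod_k t k ^ a k (e i) != 0.
    by apply/prodf_neq0 => k _; exact: expfz_neq0.
  apply/(mulIf te0); rewrite !rmorphN /=.
  rewrite (raddf_sum (map_mpoly phi)) (raddf_sum (meval w)).
  apply/eqP; rewrite mulNr eq_sym -addr_eq0 mulr_suml -[X in _ == X](ct i).
  rewrite [X in _ == X](bigD1 (e i))//= lamE eqxx mul1r; apply/eqP; congr (_ + _).
  rewrite [RHS](bigID (mem (codom e)))/= [X in _ = X + _]big1 ?add0r; last first.
    move=> {}m /andP[/andP[_ mi] /codomP[l ml]].
    rewrite ml lamE; case: eqVneq => [il|]; last by rewrite !mul0r.
    by rewrite ml il eqxx in mi.
  apply: eq_big => [{}m|{}m /andP[mT me]].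
    rewrite -andbA; congr (_ && _); apply/idP/andP => [me|[]//]; split=> //.
    by apply: contraNneq me => ->; exact: codom_f.
  rewrite !rmorphM /= !rmorph_int evY ?free_n0// W_free// !rmorph_prod /=.
  rewrite -!mulrA; congr (_ * (_ * _)); apply: (mulfI tN0); rewrite mulVKf//.
  rewrite -!big_split /=; apply: eq_bigr => k _.
  rewrite !rmorphXn /= evtau !exprnP gez0_abs// -!expfzDr//.
  by congr (_ ^ _); ring.
have := meval_map_comp_mpoly phi Q P w; rewrite QP rmorph0 meval0 => ->.
by apply: meval_eq => m; rewrite evP.
Qed.

(** * Lattice-convex sets and unimodular frames *)

Definition cross (u w : int * int) : int := u.1 * w.2 - u.2 * w.1.

(** Convex combinations of three points with rational weights, cleared of denominators so that all
    computations stay in [int]. *)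
Definition lattice_convex (T : set (int * int)) : Prop :=
  forall (p q r m : int * int) (a b c : int),
    T p -> T q -> T r -> 0 <= a -> 0 <= b -> 0 <= c -> 0 < a + b + c ->
    (a + b + c) * m.1 = a * p.1 + b * q.1 + c * r.1 ->
    (a + b + c) * m.2 = a * p.2 + b * q.2 + c * r.2 -> T m.

(** The vectors [u] and [w] span a sublattice of index [cross u w]. A lattice vector outside it,
    translated into the fundamental parallelogram, is [v]: its coordinates there are [cross v w] and
    [cross u v] divided by [cross u w]. *)
Lemma cross_reduce (u w : int * int) : 1 < cross u w ->
  exists v, [/\ 0 <= cross v w, cross v w < cross u w,
    0 <= cross u v, cross u v < cross u w & (0 < cross v w) || (0 < cross u v)].
Proof.
set D := cross u w => D1.
have red (v0 : int * int) : exists v,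
    cross v w = (cross v0 w %% D)%Z /\ cross u v = (cross u v0 %% D)%Z.
  pose x := (cross v0 w %/ D)%Z; pose y := (cross u v0 %/ D)%Z.
  exists (v0.1 - x * u.1 - y * w.1, v0.2 - x * u.2 - y * w.2).
  rewrite /modz -/x -/y /D /cross /=; split; ring.
have D0 : D != 0 by rewrite gt_eqF// (lt_trans _ D1).
have Dp : 0 < D by exact: lt_trans D1.
suff [v0 nz] : exists v0 : int * int,
    ((cross v0 w %% D)%Z != 0) || ((cross u v0 %% D)%Z != 0).
  have [v [vw uv]] := red v0; exists v; rewrite vw uv.
  rewrite !modz_ge0// !ltz_pmod//; split=> //.
  by rewrite !lt_def !modz_ge0// !andbT.
(* Otherwise the vectors (1, 0) and (0, 1) show that [D] divides all entries of [u] and [w], so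
   [D ^ 2] divides their determinant [D], against [1 < D]. *)
apply: contrapT => /forallNP all0.
have := all0 (1, 0); have := all0 (0, 1); rewrite /cross /=.
rewrite !mul1r !mul0r !mulr1 !mulr0.
rewrite !subr0 !sub0r => /negP; rewrite negb_or !negbK => /andP[w1 u1].
move=> /negP; rewrite negb_or !negbK => /andP[w2 u2].
have dv z : (z %% D)%Z == 0 -> exists k, z = k * D.
  by move=> /eqP z0; exists (z %/ D)%Z; rewrite {1}(divz_eq z D) z0 addr0.
have [a ua] := dv _ u1; have [b ub] := dv _ u2.
have [c wc] := dv _ w1; have [d wd] := dv _ w2.
have u2E : u.2 = - b * D by rewrite mulNr -ub opprK.
have w1E : w.1 = - c * D by rewrite mulNr -wc opprK.
have DE : u.1 * w.2 - u.2 * w.1 = D by [].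
have : D * (D * (a * d - b * c) - 1) = 0.
  by rewrite mulrBr mulr1 -[X in _ - X]DE ua wd u2E w1E; ring.
move/eqP; rewrite mulf_eq0 (negbTE D0) subr_eq0 /= => /eqP D_unit.
have : (D %| 1)%Z by apply/dvdzP; exists (a * d - b * c); rewrite mulrC D_unit.
by rewrite dvdz1 -eqz_nat gez0_abs ?ltW// => /eqP De; rewrite De ltxx in D1.
Qed.

(** Descent on [cross u w], twice the area of the triangle on [p], [p + u] and [p + w]. *)
Lemma unimodular_triangle (T : set (int * int)) (p u w : int * int) :
  lattice_convex T -> T p -> T (p + u) -> T (p + w) -> 0 < cross u w ->
  exists q u' w', [/\ T q, T (q + u'), T (q + w') & cross u' w' = 1].
Proof.
move=> convT.
have [n] := ubnP (absz (cross u w)).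
elim: n u w => // n IH u w ltn Tp Tu Tw D0.
have [D1|D1] := leP (cross u w) 1.
  by exists p, u, w; split=> //; lia.
(* A lattice point in the fundamental parallelogram that is not a vertex, or its
   mirror image, lies in the triangle and cuts off a smaller one. *)
suff [v [/andP[vw0 vwD] /andP[uv0 uvD] nz sD]] : exists v,
    [/\ 0 <= cross v w < cross u w, 0 <= cross u v < cross u w,
    (0 < cross v w) || (0 < cross u v) & cross v w + cross u v <= cross u w].
  have Tv : T (p + v).
    (* By Cramer's rule, the barycentric coordinates of [p + v] scaled by [cross u w]. *)
    apply: (convT _ _ _ _ (cross u w - cross v w - cross u v) (cross v w)
      (cross u v)
      Tp Tu Tw) => //=; rewrite /cross in D0 vw0 uv0 sD *; first 2 last.
    - ring.
    - ring.
    - lia.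
    - lia.
  case/orP: nz => nz; first by apply: (IH v w) => //; lia.
  by apply: (IH u v) => //; lia.
have [v [vw0 vwD uv0 uvD nz]] := cross_reduce D1.
have [sD|sD] := leP (cross v w + cross u v) (cross u w).
  by exists v; rewrite vw0 uv0.
have e1 : cross (u + w - v) w = cross u w - cross v w by rewrite /cross /=; ring.
have e2 : cross u (u + w - v) = cross u w - cross u v by rewrite /cross /=; ring.
exists (u + w - v); rewrite e1 e2; split; lia.
Qed.

Definition dot (a v : int * int) : int := a.1 * v.1 + a.2 * v.2.

Lemma primitive_direction (d : int * int) : d != 0 ->
  exists (g : int) (u a : int * int),
    [/\ 0 < g, d.1 = g * u.1, d.2 = g * u.2 & dot a u = 1].
Proof.
case: d => x y d0; pose g := gcdz x y.
have g0 : g != 0 by rewrite gcdz_eq0 -[_ && _]/((x, y) == 0).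
have gp : 0 < g by rewrite lt_def g0.
have [x' xg] := dvdzP (dvdz_gcdl x y); have [y' yg] := dvdzP (dvdz_gcdr x y).
have [a [b abg]] := Bezoutz x y.
exists g, (x', y'), (a, b); split=> //=; rewrite 1?mulrC//.
apply: (mulIf g0); rewrite mul1r /dot /= -[RHS]abg.
by rewrite [X in _ = _ * X + _]xg [X in _ = _ + _ * X]yg -/g; ring.
Qed.

(** The forms [a k] are dual to the vectors [u k] and read off integer coordinates with origin [p].
    The three cases are [T] not collinear, collinear with at least two points, and a single
    point. *)
Lemma unimodular_frame (T : set (int * int)) : T !=set0 -> lattice_convex T ->
  exists (p : int * int) (r : nat) (u a : 'I_r -> int * int),
    [/\ T p, forall k, T (p + u k),
        forall k l, dot (a k) (u l) = (k == l)%:R &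
        forall m, T m -> m.1 = p.1 + \sum_k dot (a k) (m - p) * (u k).1 /\
                         m.2 = p.2 + \sum_k dot (a k) (m - p) * (u k).2].
Proof.
move=> [p Tp] convT.
have [[q [u [w [Tq Tu Tw uw]]]]|flat] := pselect (exists q u w,
    [/\ T q, T (q + u), T (q + w) & cross u w != 0]).
  have [{}q [{Tu}u [{Tw}w [{}Tq Tu Tw {}uw]]]] : exists q u w,
      [/\ T q, T (q + u), T (q + w) & cross u w = 1].
    have [uw0|uw0] := ltrP 0 (cross u w).
      exact: (unimodular_triangle convT Tq Tu Tw).
    apply: (unimodular_triangle convT Tq Tw Tu).
    by have : cross w u = - cross u w by [rewrite /cross; ring]; lia.
  (* The dual forms are [cross _ w] and [cross u _]. *)
  exists q, 2%N, (fun k => if k == ord0 then u else w),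
    (fun k => if k == ord0 then (w.2, - w.1) else (- u.2, u.1)).
  rewrite /dot; rewrite /cross in uw; split=> //.
  - by move=> k; case: ifP.
  - by case=> [[|[|]]]// ?; case=> [[|[|]]]// ?; rewrite -!val_eqE /=; lia.
  - move=> m _; rewrite !big_ord_recl !big_ord0 /=; split.
      by transitivity (q.1 + (m.1 - q.1) * (u.1 * w.2 - u.2 * w.1)); [rewrite uw|];
        ring.
    by transitivity (q.2 + (m.2 - q.2) * (u.1 * w.2 - u.2 * w.1)); [rewrite uw|];
        ring.
have [[d [d0 Td]]|single] := pselect (exists d, d != 0 /\ T (p + d)).
  have [g [u [a [g0 d1 d2 au]]]] := primitive_direction d0.
  have Tu : T (p + u).
    (* As [d = g u], the point [p + u] lies between [p] and [p + d] with weights [g - 1] and 1. *)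
    apply: (convT p (p + d) p _ (g - 1) 1 0) => //=; first 2 last.
    - by rewrite d1; ring.
    - by rewrite d2; ring.
    - lia.
    - lia.
  exists p, 1%N, (fun=> u), (fun=> a); split=> //.
    by move=> k l; rewrite !ord1 eqxx.
  move=> m Tm; rewrite !big_ord1.
  have : cross u (m - p) = 0.
    apply/eqP/negP => /negP mu; apply: flat; exists p, u, (m - p).
    by rewrite [p + (m - p)]addrC subrK.
  rewrite /cross /dot /= => umE; rewrite /dot in au.
  have e1 : m.1 - p.1 = (a.1 * (m.1 - p.1) + a.2 * (m.2 - p.2)) * u.1.
    rewrite -[LHS]mulr1 -au.
    by apply/eqP; rewrite -subr_eq0 -(mulr0 (- a.2)) -umE; apply/eqP; ring.
  have e2 : m.2 - p.2 = (a.1 * (m.1 - p.1) + a.2 * (m.2 - p.2)) * u.2.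
    rewrite -[LHS]mulr1 -au.
    by apply/eqP; rewrite -subr_eq0 -(mulr0 a.1) -umE; apply/eqP; ring.
  by rewrite -e1 -e2 ![_ + (_ - _)]addrC !subrK.
exists p, 0%N, (fun=> 0), (fun=> 0); split=> //; try by case.
move=> m Tm; rewrite !big_ord0 !addr0.
have [->//|mp] := eqVneq m p.
case: single; exists (m - p); rewrite subr_eq0 mp.
by rewrite [p + (m - p)]addrC subrK.
Qed.

(** * Degenerate coefficients for a single face *)

Lemma torus_monomial_frame (E : fieldType) (x y : E) r (p m : int * int)
    (u : 'I_r -> int * int) (z : 'I_r -> int) : x != 0 -> y != 0 ->
  m.1 = p.1 + \sum_k z k * (u k).1 -> m.2 = p.2 + \sum_k z k * (u k).2 ->
  x ^ m.1 * y ^ m.2 =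
  x ^ p.1 * y ^ p.2 * \prod_k (x ^ (u k).1 * y ^ (u k).2) ^ z k.
Proof.
move=> x0 y0 -> ->; rewrite !expfzDr// mulrACA; congr (_ * _).
have prodX (w : E) (b : 'I_r -> int) : w != 0 ->
    w ^ (\sum_k b k) = \prod_k w ^ b k.
  by move=> w0; apply: (big_morph (fun n => w ^ n)) => // ? ?; rewrite expfzDr.
rewrite !prodX// -big_split /=; apply: eq_bigr => k _.
by rewrite expfzMl !exprz_exp ![z k * _]mulrC.
Qed.

Lemma degenerate_face_locus (F E : fieldType) (phi : {rmorphism F -> E}) n
    (pt : 'I_n -> int * int) (T : {set 'I_n}) :
  T != finset.set0 -> lattice_convex [set m | exists2 i, i \in T & pt i = m] ->
  exists2 Q : {mpoly F[n]}, Q != 0 & forall (c : 'I_n -> E) (x y : E),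
    x != 0 -> y != 0 ->
    \sum_(i in T) c i * x ^ (pt i).1 * y ^ (pt i).2 = 0 ->
    \sum_(i in T) (pt i).1%:~R * (c i * x ^ (pt i).1 * y ^ (pt i).2) = 0 ->
    \sum_(i in T) (pt i).2%:~R * (c i * x ^ (pt i).1 * y ^ (pt i).2) = 0 ->
    (map_mpoly phi Q).@[c] = 0.
Proof.
move=> /set0Pn[i0 i0T] convT.
have [|p [r [u [a [[ip ipT ptp] Tu au frame]]]]] := unimodular_frame _ convT.
  by exists (pt i0); exists i0.
have /boolp.choice[iu iuE] : forall k, exists i, i \in T /\ pt i = p + u k.
  by move=> k; have [i iT iE] := Tu k; exists i.
pose b k i := dot (a k) (pt i - p).
pose e (k : 'I_r.+1) := oapp iu ip (unlift ord0 k).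
(* Barycentric coordinates with respect to the frame. *)
pose lam (k : 'I_r.+1) i := oapp (b^~ i) (1 - \sum_k b k i) (unlift ord0 k).
have bp k : b k ip = 0 by rewrite /b ptp subrr /dot /= !mulr0.
have bu k l : b k (iu l) = (k == l)%:R.
  by rewrite /b (iuE l).2 addrC addKr au.
have [|k l|Q Q0 QE] := @torus_elimination F E phi n r T e b lam.
- by move=> k; rewrite /e; case: unliftP => [k' _|_] //=; case: (iuE k').
- rewrite /lam /e; case: (unliftP ord0 k) => [k' ->|->] /=;
    case: (unliftP ord0 l) => [l' ->|->] /=.
  + by rewrite bu (inj_eq lift_inj).
  + by rewrite bp.
  + rewrite (bigD1 l')//= bu eqxx big1 ?addr0 ?subrr// => k' kl.
    by rewrite bu (negbTE kl).
  + by rewrite big1 ?subr0// => k1 _; exact: bp.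
exists Q => // c x y x0 y0 S0 S1 S2.
apply: (QE _ (fun k => x ^ (u k).1 * y ^ (u k).2)).
  by move=> k; rewrite mulf_neq0 ?expfz_neq0.
move=> k.
(* [lam k] is an integral affine function of the exponent, so equation [k] is an integer combination
   of [S0], [S1] and [S2], in every characteristic. *)
have [al [be [ga lam_affine]]] : exists al be ga : int, forall i,
    lam k i = al + be * (pt i).1 + ga * (pt i).2.
  rewrite /lam; case: unlift => [l|] /=.
    exists (- dot (a l) p), (a l).1, (a l).2 => i; rewrite /b /dot /=; ring.
  exists (1 + \sum_l dot (a l) p), (- \sum_l (a l).1), (- \sum_l (a l).2) => i.
  rewrite -!addrA; congr (_ + _); rewrite !mulNr !mulr_suml -!sumrN -!big_split /=.
  by apply: eq_bigr => l _; rewrite /b /dot /=; ring.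
have p0 : x ^ p.1 * y ^ p.2 != 0 by rewrite mulf_neq0 ?expfz_neq0.
apply/(mulfI p0); rewrite mulr0 mulr_sumr.
transitivity (\sum_(i in T) (al%:~R * (c i * x ^ (pt i).1 * y ^ (pt i).2) +
    be%:~R * ((pt i).1%:~R * (c i * x ^ (pt i).1 * y ^ (pt i).2)) +
    ga%:~R * ((pt i).2%:~R * (c i * x ^ (pt i).1 * y ^ (pt i).2)))).
  apply: eq_bigr => i iT; have [|m1 m2] := frame (pt i); first by exists i.
  rewrite lam_affine -[c i * _ * _]mulrA (torus_monomial_frame x0 y0 m1 m2).
  rewrite !rmorphD !rmorphM /= /b; ring.
by rewrite !big_split /= -!mulr_sumr S0 S1 S2 !mulr0 !addr0.
Qed.

(** * The prime subfield as a field *)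

Definition prime_pred (K : fieldType) : {pred K} :=
  fun x => `[< prime_subfield x >].

Lemma prime_pred_divring (K : fieldType) : divring_closed (@prime_pred K).
Proof.
split=> [|x y /asboolP xP /asboolP yP|x y /asboolP xP /asboolP yP];
  apply/asboolP => S SP; have [S1 SB SV] := SP => //.
- by apply: SB; [exact: xP | exact: yP].
- by apply: SV; [exact: xP | exact: yP].
Qed.

HB.instance Definition _ (K : fieldType) :=
  GRing.isDivringClosed.Build K (@prime_pred K) (@prime_pred_divring K).

(** A relation found over this field has its coefficients in the prime subfield, which gives the
    field of definition of the locus. *)
Definition prime_field (K : fieldType) : Type := {x : K | x \in @prime_pred K}.

HB.instance Definition _ (K : fieldType) := SubChoice.on (prime_field K).
HB.instance Definition _ (K : fieldType) :=
  [SubChoice_isSubUnitRing of prime_field K by <:].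
HB.instance Definition _ (K : fieldType) :=
  [SubNzRing_isSubComNzRing of prime_field K by <:].
HB.instance Definition _ (K : fieldType) :=
  [SubComUnitRing_isSubIntegralDomain of prime_field K by <:].
HB.instance Definition _ (K : fieldType) :=
  [SubIntegralDomain_isSubField of prime_field K by <:].

Lemma prime_field_val (K : fieldType) (x : prime_field K) : prime_subfield (val x).
Proof. exact/asboolP/(valP x). Qed.

(** * Codimension of a hypersurface *)

(** Reduction modulo [B] reads off the lowest digit. This keeps distinct monomials apart in the
    Kronecker substitution. *)
Lemma digits_inj B n (a b : 'I_n -> nat) :
  (forall i, a i < B)%N -> (forall i, b i < B)%N ->
  (\sum_i a i * B ^ i = \sum_i b i * B ^ i)%N -> a =1 b.
Proof.
elim: n a b => [|n IH] a b aB bB; first by move=> _ [].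
have shift (c : 'I_n.+1 -> nat) : (\sum_i c i * B ^ i =
    (\sum_(i < n) c (lift ord0 i) * B ^ i) * B + c ord0)%N.
  rewrite big_ord_recl expn0 muln1 addnC big_distrl; congr (_ + _)%N.
  by apply: eq_bigr => i _; rewrite expnSr mulnA.
rewrite !shift => e.
have ab0 : a ord0 = b ord0.
  by have := congr1 (modn^~ B) e; rewrite !modnMDl !modn_small.
move: e; rewrite ab0 => /addIn/eqP; rewrite eqn_pmul2r; last first.
  exact: leq_trans (aB ord0).
move=> /eqP/IH ab i; case: (unliftP ord0 i) => [i' ->|-> //].
exact: ab.
Qed.

(* Kronecker substitution x_i := z ^ (B ^ i) reduces to one variable. *)
Lemma mpoly_nonroot (E : closedFieldType) n (p : {mpoly E[n]}) :
  p != 0 -> exists v, p.@[v] != 0.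
Proof.
move=> p0; pose B := msize p; pose ka (m : 'X_{1..n}) := (\sum_i m i * B ^ i)%N.
have ltB m i : m \in msupp p -> (m i < B)%N.
  move=> mp; apply: leq_ltn_trans (msize_mdeg_lt mp).
  by rewrite mdegE (bigD1 i)//= leq_addr.
pose q := \sum_(m <- msupp p) p@_m *: 'X^(ka m) : {poly E}.
have q0 : q != 0.
  apply/eqP => /(congr1 (coefp (ka (mlead p)))); apply/eqP.
  rewrite raddf0 /q raddf_sum /= (bigD1_seq (mlead p)) ?mlead_supp ?msupp_uniq//=.
  rewrite coefZ coefXn eqxx mulr1 big_seq_cond big1 ?addr0 ?mleadc_eq0//.
  move=> m /andP[mp ml]; rewrite coefZ coefXn; case: eqVneq; rewrite ?mulr0//.
  move=> /digits_inj ml'; case/eqP: ml; apply/mnmP => i.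
  by rewrite ml'// => l; apply: ltB; rewrite ?mlead_supp.
have /closed_nonrootP[z] := q0; rewrite /root => qz.
exists (fun i : 'I_n => z ^+ (B ^ i)); apply: contra_neq qz => <-.
rewrite horner_sum mevalE; apply: eq_bigr => m _.
rewrite hornerZ hornerXn; congr (_ * _).
rewrite /ka expr_sum; apply: eq_bigr => i _.
by rewrite -exprM mulnC.
Qed.

(** Two proper closed sets lie in the zero loci of nonzero polynomials [p] and [q], and a nonroot of
    [p * q] lies in neither. *)
Lemma irreducible_affine_space (E : closedFieldType) n :
  irreducible_closed [set: 'I_n -> E].
Proof.
split.
- by exists set0; apply/seteqP; split=> // v _ p [].
- by exists (fun=> 0).
move=> A B [I ->] [J ->] AB.
have [|/existsNP[v nv]] := pselect (forall v, zero_locus I v).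
  by move=> all; left; apply/seteqP; split.
have [|/existsNP[w nw]] := pselect (forall w, zero_locus J w).
  by move=> all; right; apply/seteqP; split.
move/existsNP: nv => [p /not_implyP[Ip /eqP pv]].
move/existsNP: nw => [q /not_implyP[Jq /eqP qw]].
have pq0 : p * q != 0.
  rewrite mulf_eq0 negb_or; apply/andP; split.
    by apply: contra_neq pv => ->; rewrite meval0.
  by apply: contra_neq qw => ->; rewrite meval0.
have [z] := mpoly_nonroot pq0; rewrite mevalM mulf_eq0 negb_or => /andP[pz qz].
have : [set: 'I_n -> E] z by [].
by rewrite AB => -[/(_ _ Ip) e|/(_ _ Jq) e];
  [rewrite e eqxx in pz|rewrite e eqxx in qz].
Qed.

(** The whole space comes above [Y0] in the chain, strictly because [p] has a nonroot. *)
Lemma codim_ge1_hypersurface (E : closedFieldType) n (p : {mpoly E[n]}) :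
  p != 0 -> codim_ge (zero_locus [set p]) 1.
Proof.
move=> p0 Y0 irrY0 Y0p; have [v pv] := mpoly_nonroot p0.
exists (fun i => if i is 0 then Y0 else setT); split=> // [[|i] _//|[|i]// _].
  exact: irreducible_affine_space.
split=> // all.
by move/eqP: pv; apply; apply: (Y0p v (all v I)).
Qed.

(** * Laurent polynomials in coordinates *)

(** The support of a face part or of a derivative may lose points; sums over a fixed set of
    exponents do not depend on this. *)
Lemma leval_widen (F E : fieldType) (j : {rmorphism F -> E}) (f : laurent F)
    (A : {fset int * int}) (x y : E) : (finsupp f `<=` A)%fset ->
  leval j f x y = \sum_(m <- A) j (f m) * x ^ m.1 * y ^ m.2.
Proof.
move=> fA; apply: big_fset_incl => // m _.
by rewrite memNfinsupp => /eqP ->; rewrite rmorph0 !mul0r.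
Qed.

Lemma ddxE (F : fieldType) (f : laurent F) m :
  ddx f m = f (m.1 + 1, m.2) *~ (m.1 + 1).
Proof.
rewrite fsfun_fun; case: ifP => // /negbT mf; rewrite fsfun_dflt ?mul0rz//.
apply: contra mf => mf; apply/imfsetP; exists (m.1 + 1, m.2) => //=.
by rewrite addrK; case: m mf.
Qed.

Lemma ddyE (F : fieldType) (f : laurent F) m :
  ddy f m = f (m.1, m.2 + 1) *~ (m.2 + 1).
Proof.
rewrite fsfun_fun; case: ifP => // /negbT mf; rewrite fsfun_dflt ?mul0rz//.
apply: contra mf => mf; apply/imfsetP; exists (m.1, m.2 + 1) => //=.
by rewrite addrK; case: m mf.
Qed.

Lemma mul_leval_ddx (F E : fieldType) (j : {rmorphism F -> E}) (f : laurent F)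
    (A : {fset int * int}) (x y : E) : x != 0 -> (finsupp f `<=` A)%fset ->
  x * leval j (ddx f) x y =
  \sum_(m <- A) m.1%:~R * (j (f m) * x ^ m.1 * y ^ m.2).
Proof.
move=> x0 fA; rewrite (@leval_widen _ _ _ _ [fset (n.1 - 1, n.2) | n in A]%fset).
  rewrite big_imfset /=; last by move=> [a b] [c d] _ _ [] /addIr -> ->.
  rewrite mulr_sumr; apply: eq_bigr => -[a b] _.
  rewrite ddxE /= subrK rmorphMz -mulrzr expfzDr// exprN1.
  by field.
apply: fsubset_trans (finsupp_sub _ _ _) _.
apply/fsubsetP => _ /imfsetP[m /= mf ->]; apply: in_imfset.
exact: (fsubsetP fA).
Qed.

Lemma mul_leval_ddy (F E : fieldType) (j : {rmorphism F -> E}) (f : laurent F)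
    (A : {fset int * int}) (x y : E) : y != 0 -> (finsupp f `<=` A)%fset ->
  y * leval j (ddy f) x y =
  \sum_(m <- A) m.2%:~R * (j (f m) * x ^ m.1 * y ^ m.2).
Proof.
move=> y0 fA; rewrite (@leval_widen _ _ _ _ [fset (n.1, n.2 - 1) | n in A]%fset).
  rewrite big_imfset /=; last by move=> [a b] [c d] _ _ [] -> /addIr ->.
  rewrite mulr_sumr; apply: eq_bigr => -[a b] _.
  rewrite ddyE /= subrK rmorphMz -mulrzr expfzDr// exprN1.
  by field.
apply: fsubset_trans (finsupp_sub _ _ _) _.
apply/fsubsetP => _ /imfsetP[m /= mf ->]; apply: in_imfset.
exact: (fsubsetP fA).
Qed.

Definition exponent (S : {fset int * int}) (i : 'I_#|{: S}|) : int * int :=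
  val (enum_val i).

Lemma exponentP (S : {fset int * int}) m : m \in S -> exists i, @exponent S i = m.
Proof.
by move=> mS; exists (enum_rank [` mS]%fset); rewrite /exponent enum_rankK.
Qed.

Lemma laurent_of_exponent (F : fieldType) (S : {fset int * int})
    (v : 'I_#|{: S}| -> F) i : laurent_of v (exponent i) = v i.
Proof. by rewrite fsfun_ffun /exponent valK /= enum_valK. Qed.

Lemma finsupp_laurent_of (F : fieldType) (S : {fset int * int})
    (v : 'I_#|{: S}| -> F) : (forall i, v i != 0) -> finsupp (laurent_of v) = S.
Proof.
move=> v0; apply/eqP; rewrite eqEfsubset finsupp_sub; apply/fsubsetP => m.
by move=> /exponentP[i <-]; rewrite mem_finsupp laurent_of_exponent.
Qed.

Lemma big_exponent (E : fieldType) (S : {fset int * int}) (G : int * int -> E) :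
  \sum_(m <- S) G m = \sum_i G (@exponent S i).
Proof.
rewrite big_seq_fsetE (reindex (fun i : 'I_#|{: S}| => enum_val i))//=.
exact/onW_bij/enum_val_bij.
Qed.

Lemma face_partE (R : realType) (F : fieldType) (f : laurent F)
    (g : set 'rV[R]_2) m :
  face_part f g m = if `[< g (intpt R m) >] then f m else 0.
Proof.
rewrite fsfun_fun !inE /=; case: asboolP; rewrite ?andbF// andbT => _.
by case: finsuppP.
Qed.

(** * Convexity of hulls and faces *)

Lemma convex_setE (R : realType) (V : lmodType R) (C : set V) x y (s : R) :
  convex_set C -> C x -> C y -> 0 <= s -> s <= 1 -> C (s *: x + (1 - s) *: y).
Proof.
move=> convC Cx Cy s0 s1; have := convC x y (Itv01 s0 s1).
by rewrite !inE; apply.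
Qed.

Lemma convex_set_triangle (R : realType) (V : lmodType R) (C : set V) x y z
    (a b c : R) : convex_set C -> C x -> C y -> C z ->
  0 <= a -> 0 <= b -> 0 <= c -> a + b + c = 1 -> C (a *: x + b *: y + c *: z).
Proof.
move=> convC Cx Cy Cz a0 b0 c0 abc.
(* For [a != 1] the point lies between [x] and the point of the segment from [y] to [z] with weights
   [b / (1 - a)] and [c / (1 - a)]. *)
have [a1|a1] := eqVneq a 1.
  have -> : b = 0 by lra.
  have -> : c = 0 by lra.
  by rewrite a1 !scale0r scale1r !addr0.
have d0 : 0 < 1 - a by rewrite lt_def subr_eq0 eq_sym a1; lra.
have -> : a *: x + b *: y + c *: z =
    a *: x + (1 - a) *: ((b / (1 - a)) *: y + (1 - b / (1 - a)) *: z).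
  rewrite scalerDr !scalerA -addrA; congr (_ + (_ *: _ + _ *: _)).
    by rewrite mulrC divfK ?gt_eqF.
  by rewrite mulrBr mulr1 [_ * (b / _)]mulrC divfK ?gt_eqF//; lra.
apply: convex_setE => //; last by lra.
apply: convex_setE => //; first by rewrite divr_ge0// ltW.
by rewrite ler_pdivrMr// mul1r; lra.
Qed.

Lemma lattice_convex_intpt (R : realType) (C : set 'rV[R]_2) :
  convex_set C -> lattice_convex [set m | C (intpt R m)].
Proof.
move=> convC p q r m a b c Cp Cq Cr a0 b0 c0 s0 m1 m2 /=.
pose s : R := (a + b + c)%:~R; have sp : 0 < s by rewrite ltr0z.
have -> : intpt R m = (a%:~R / s) *: intpt R p + (b%:~R / s) *: intpt R q +
    (c%:~R / s) *: intpt R r.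
  apply/rowP => k; rewrite !mxE; apply: (mulfI (lt0r_neq0 sp)).
  rewrite !mulrDr !mulrA ![s * _ / s]mulrAC divff ?lt0r_neq0// !mul1r.
  by rewrite /s -!rmorphM -!rmorphD /=; congr (_%:~R); case: ifP.
apply: convex_set_triangle => //; try by rewrite divr_ge0 ?ler0z// ltW.
by rewrite -!mulrDl -!rmorphD divff// lt0r_neq0.
Qed.

Lemma convex_conv_hull (R : realType) (V : lmodType R) (A : set V) :
  convex_set (conv_hull A).
Proof.
move=> x y t; rewrite !inE => Ax Ay B [convB AB].
have := convB x y t; rewrite !inE; apply; [exact: Ax|exact: Ay].
Qed.

Lemma convex_face (R : realType) (V : lmodType R) (P g : set V) :
  convex_set P -> is_face P g -> convex_set g.
Proof.
move=> convP [l ->] x y t; rewrite !inE => -[Px lx] [Py ly]; split.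
  by have := convP x y t; rewrite !inE; apply.
move=> q Pq; rewrite linearD !linearZ /= /unstable.onem.
have t0 : 0 <= t%:num by [].
have t1 : 0 <= 1 - t%:num :> R by rewrite subr_ge0.
have := ler_wpM2l t0 (lx _ Pq); have := ler_wpM2l t1 (ly _ Pq); lra.
Qed.

Lemma conv_hull_sub (R : realType) (V : lmodType R) (A B : set V) :
  convex_set B -> A `<=` B -> conv_hull A `<=` B.
Proof. exact: smallest_sub. Qed.

Lemma convex_halfspace (R : realType) (V : lmodType R) (l : {scalar V}) (b : R) :
  convex_set [set x | l x <= b].
Proof.
move=> x y t; rewrite !inE /= => lx ly.
rewrite linearD !linearZ /= /unstable.onem.
have t0 : 0 <= t%:num by [].
have t1 : 0 <= 1 - t%:num :> R by rewrite subr_ge0.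
have := ler_wpM2l t0 lx; have := ler_wpM2l t1 ly; lra.
Qed.

(** A linear form attains its maximum over the hull at a generator: the half-space below its maximum
    over [A] is convex and contains the generators. *)
Lemma face_conv_hull_meets (R : realType) (A : {fset int * int})
    (g : set 'rV[R]_2) : A != fset0 ->
  is_face (conv_hull (@intpt R @` [set` A])) g ->
  exists2 m, m \in A & g (intpt R m).
Proof.
case/fset0Pn => m0 m0A [l ->].
case: (@arg_maxP _ R {: A} [` m0A]%fset predT
  (fun m => l (intpt R (val m))) isT) => -[m mA] _ mmax.
have mP : conv_hull (@intpt R @` [set` A]) (intpt R m).
  by apply: sub_gen_smallest; exists m.
exists m => //; split=> // q.
apply: (@conv_hull_sub _ _ _ [set x | l x <= l (intpt R m)]).
  exact: convex_halfspace.
by move=> _ [m' /= m'A <-]; exact: (mmax [` m'A]%fset isT).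
Qed.

(** * The degenerate locus *)

(** [Q] is the product of all coordinates and of one factor for each set [T] of indices, so that it
    serves every face at once. *)
Lemma degenerate_locus (F E : fieldType) (phi : {rmorphism F -> E}) n
    (pt : 'I_n -> int * int) :
  exists Q : {mpoly F[n]}, [/\ Q != 0,
    forall (c : 'I_n -> E) i, c i = 0 -> (map_mpoly phi Q).@[c] = 0 &
    forall (T : {set 'I_n}) (c : 'I_n -> E) (x y : E),
      T != finset.set0 ->
      lattice_convex [set m | exists2 i, i \in T & pt i = m] ->
      x != 0 -> y != 0 ->
      \sum_(i in T) c i * x ^ (pt i).1 * y ^ (pt i).2 = 0 ->
      \sum_(i in T) (pt i).1%:~R * (c i * x ^ (pt i).1 * y ^ (pt i).2) = 0 ->
      \sum_(i in T) (pt i).2%:~R * (c i * x ^ (pt i).1 * y ^ (pt i).2) = 0 ->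
      (map_mpoly phi Q).@[c] = 0].
Proof.
pose good (T : {set 'I_n}) := T != finset.set0 /\
  lattice_convex [set m | exists2 i, i \in T & pt i = m].
have /boolp.choice[Qf QfE] : forall T : {set 'I_n}, exists Q : {mpoly F[n]},
    Q != 0 /\ (good T -> forall (c : 'I_n -> E) (x y : E), x != 0 -> y != 0 ->
      \sum_(i in T) c i * x ^ (pt i).1 * y ^ (pt i).2 = 0 ->
      \sum_(i in T) (pt i).1%:~R * (c i * x ^ (pt i).1 * y ^ (pt i).2) = 0 ->
      \sum_(i in T) (pt i).2%:~R * (c i * x ^ (pt i).1 * y ^ (pt i).2) = 0 ->
      (map_mpoly phi Q).@[c] = 0).
  move=> T; have [[T0 convT]|nT] := pselect (good T).
    by have [Q Q0 QE] := degenerate_face_locus phi T0 convT; exists Q; split.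
  (* A set [T] that is empty or not lattice convex gets the factor 1. *)
  by exists 1; split=> //; exact: oner_neq0.
exists ((\prod_i 'X_i) * \prod_T Qf T); split.
- apply: mulf_neq0; apply/prodf_neq0; last by move=> T _; case: (QfE T).
  move=> i _; apply/eqP => /(congr1 (mcoeff U_(i))); rewrite mcoeffXU eqxx mcoeff0.
  by apply/eqP/oner_neq0.
- move=> c i ci; rewrite !rmorphM /= !rmorph_prod /= (bigD1 i)//=.
  by rewrite map_mpolyX mevalXU ci !mul0r.
- move=> T c x y T0 convT x0 y0 S0 S1 S2.
  rewrite !rmorphM /= !rmorph_prod /= [X in _ * X](bigD1 T)//=.
  by rewrite ((QfE T).2 (conj T0 convT) c x y)// mul0r mulr0.
Qed.

Lemma map_mpoly_neq0 (F E : fieldType) (phi : {rmorphism F -> E}) n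
    (p : {mpoly F[n]}) : p != 0 -> map_mpoly phi p != 0.
Proof.
apply: contra_neq => /mpolyP p0; apply/mpolyP => m; apply/eqP.
by have := p0 m; rewrite mcoeff_map_mpoly !mcoeff0 => /eqP; rewrite fmorph_eq0.
Qed.

Lemma newton_degenerate_equations (R : realType) (Gamma : set 'rV[R]_2)
    (L E : fieldType) (j : {rmorphism L -> E})
    (v : 'I_#|{: lattice_points Gamma}| -> L) (g : set 'rV[R]_2) (x y : E) :
  let S := lattice_points Gamma in
  let pt := @exponent S in
  let T := [set i | `[< g (intpt R (pt i)) >]]%SET in
  let h := face_part (laurent_of v) g in
  x != 0 -> y != 0 ->
  [/\ leval j h x y =
        \sum_(i in T) (j \o v) i * x ^ (pt i).1 * y ^ (pt i).2,
      x * leval j (ddx h) x y =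
        \sum_(i in T) (pt i).1%:~R *
          ((j \o v) i * x ^ (pt i).1 * y ^ (pt i).2) &
      y * leval j (ddy h) x y =
        \sum_(i in T) (pt i).2%:~R *
          ((j \o v) i * x ^ (pt i).1 * y ^ (pt i).2)].
Proof.
move=> S pt T h x0 y0.
have hS : (finsupp h `<=` S)%fset.
  apply/fsubsetP => m; rewrite mem_finsupp face_partE.
  case: ifP; rewrite ?eqxx// => _.
  by rewrite -mem_finsupp; apply: (fsubsetP (finsupp_sub _ _ _)).
have hE i : j (h (pt i)) = if i \in T then (j \o v) i else 0.
  by rewrite face_partE laurent_of_exponent inE; case: asboolP; rewrite ?rmorph0.
rewrite (leval_widen _ _ _ hS) (mul_leval_ddx _ _ x0 hS).
rewrite (mul_leval_ddy _ _ y0 hS).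
rewrite !big_exponent; split; rewrite [RHS]big_mkcond; apply: eq_bigr => i _;
  by rewrite hE; case: ifP; rewrite // !mul0r ?mulr0.
Qed.

Theorem proposition1 (R : realType) (K : fieldType) (Kbar : closedFieldType)
    (iota : {rmorphism K -> Kbar})
    (iota_alg : forall z : Kbar, algebraicOver iota z)
    (Gamma : set 'rV[R]_2) (Gamma_poly : integral_polytope Gamma) :
  let S := lattice_points Gamma in
  exists V : set ('I_#|{: S}| -> Kbar),
    [/\ algebraic_set V,
        codim_ge V 1,
        defined_over_prime_subfield iota V &
        forall (L : fieldType) (i : {rmorphism K -> L})
               (j : {rmorphism L -> Kbar}),
          j \o i =1 iota ->
          forall v : 'I_#|{: S}| -> L,
            ~ newton_nondegenerate R j (laurent_of v) -> V (j \o v)].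
Proof.
move=> S; pose incl : {rmorphism prime_field K -> K} := \val.
pose phi : {rmorphism prime_field K -> Kbar} := iota \o incl.
have [Q [Q0 Qcoord Qface]] := degenerate_locus phi (@exponent S).
have phiQ : map_mpoly iota (map_mpoly incl Q) = map_mpoly phi Q.
  by apply/mpolyP => m; rewrite !mcoeff_map_mpoly.
exists (zero_locus [set map_mpoly phi Q]); split.
- by exists [set map_mpoly phi Q].
- exact/codim_ge1_hypersurface/map_mpoly_neq0.
- exists [set map_mpoly incl Q]; last by rewrite image_set1 phiQ.
  by move=> _ -> m; rewrite mcoeff_map_mpoly; exact: prime_field_val.
move=> L i j _ v deg _ ->.
(* A zero coefficient is caught by the coordinate factor of [Q]; otherwise the support is all of
   [S]. *)
have [[k vk]|v0] := pselect (exists k, v k = 0).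
  by apply: (Qcoord _ k); rewrite /= vk rmorph0.
have {}v0 k : v k != 0 by apply/eqP => vk; apply: v0; exists k.
have suppv : finsupp (laurent_of v) = S := finsupp_laurent_of v0.
apply: contrapT => Qv; apply: deg => g gface [x [y [x0 y0 e0 e1 e2]]]; apply: Qv.
have [E0 E1 E2] := newton_degenerate_equations (Gamma := Gamma) j v g x0 y0.
have inS m : (m \in S) <-> Gamma (intpt R m) := mem_lattice_points Gamma_poly m.
have newtonS : newton_polytope R (laurent_of v) `<=` Gamma.
  rewrite /newton_polytope suppv; apply: conv_hull_sub.
    by case: Gamma_poly => s _ ->; exact: convex_conv_hull.
  by move=> _ [m /= mS <-]; exact/inS.
(* Hence the exponents indexed by [T] are all the lattice points of [g] and inherit its
   convexity. *)
have gS m : g (intpt R m) -> m \in S.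
  by case: gface => l -> [mN _]; apply/inS/newtonS.
(* The first generator of [Gamma] lies in [S], so that every face of the Newton polytope meets
   [S]. *)
have S0 : S != fset0.
  case: Gamma_poly inS => [[//|m s] _ ->] inS; apply/fset0Pn; exists m.
  apply/inS; apply: sub_gen_smallest; exists m => //=; exact: mem_head.
pose T := [set k | `[< g (intpt R (@exponent S k)) >]]%SET.
apply: (Qface T) x0 y0 _ _ _; rewrite -?E0 -?E1 -?E2 //.
- apply/set0Pn; have [|m mS gm] := @face_conv_hull_meets R S g S0.
    by move: gface; rewrite /newton_polytope suppv.
  by have [k km] := exponentP mS; exists k; rewrite inE km; exact/asboolP.
- rewrite (_ : [set m | _] = [set m | g (intpt R m)]).
    apply: lattice_convex_intpt; apply: convex_face gface.
    exact: convex_conv_hull.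
  apply/seteqP; split=> m /=; first by case=> k; rewrite inE => /asboolP + <-.
  move=> gm; have [k km] := exponentP (gS _ gm); exists k => //.
  by rewrite inE km; exact/asboolP.
Qed.
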